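(* Let $(R,\mathfrak m)$ be a quasi-local commutative ring and let $M$ be an $R$-module. Suppose that $N$ is a strongly irreducible submodule of $M$ such that $N\neq N:_M\mathfrak m$. Then the following conditions hold: (i) the submodule $N:_M\mathfrak m$ of $M$ is cyclic; (ii) $N=\mathfrak m(N:_M\mathfrak m)$; (iii) for each submodule $K$ of $M$, either $K\subseteq N$ or $N:_M\mathfrak m\subseteq K$.
   Context: All rings are commutative with non-zero identity. A quasi-local ring $(R,\mathfrak m)$ is a (not necessarily Noetherian) ring with a unique maximal ideal $\mathfrak m$. A submodule $N$ of an $R$-module $M$ is strongly irreducible if for all submodules $K,L$ of $M$, $K\cap L\subseteq N$ implies $K\subseteq N$ or $L\subseteq N$. For an ideal $\mathfrak a$ of $R$, $N:_M\mathfrak a=\{x\in M: \mathfrak a x\subseteq N\}$. *)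

(* Defs.v *)
From mathcomp Require Import all_boot all_algebra.
From mathcomp Require Import boolp classical_sets.

Set Implicit Arguments.
Unset Strict Implicit.
Unset Printing Implicit Defensive.

Import GRing.Theory.
Local Open Scope classical_set_scope.
Local Open Scope ring_scope.

Section Rings.
Variable R : comNzRingType.
Implicit Types I J m : set R.

(* [idealr_closed] already includes properness (1 \notin I). *)
Definition proper_ideal_set I : Prop := idealr_closed [in I].

Definition maximal_ideal I : Prop :=
  proper_ideal_set I /\ forall J, proper_ideal_set J -> I `<=` J -> J = I.

Definition quasi_local m : Prop :=
  maximal_ideal m /\ forall I, maximal_ideal I -> I = m.

End Rings.

Section Modules.
Variables (R : comNzRingType) (M : lmodType R).
Implicit Types (a : set R) (N K L : set M).

Definition submodule N : Prop := GRing.submod_closed [in N].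

Definition strongly_irreducible N : Prop :=
  submodule N /\
  forall K L, submodule K -> submodule L -> K `&` L `<=` N ->
    K `<=` N \/ L `<=` N.

Definition colon N a : set M := [set x | forall r, a r -> N (r *: x)].

(* The submodule generated by the products r *: x, i.e. their finite sums. *)
Definition ideal_mul a N : set M :=
  smallest submodule [set r *: x | r in a & x in N].

Definition cyclic_submodule N : Prop :=
  exists x : M, N = [set r *: x | r in [set: R]].

End Modules.

(* Main.v *)
Require Import Defs.
From mathcomp Require Import all_boot all_algebra.
From mathcomp Require Import boolp classical_sets.

(** Write [T = N :_M m]. Strong irreducibility makes any two submodules not
    contained in [N] meet outside [N], and scalars outside [m] are units.
    Let [x] be in [T] but not in [N]. Comparing [N + R x] with [N + R y] for
    [y] in [T] gives [T = N + R x]; comparing [R x] with [R (x + n)] for [n] in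
    [N] gives an equation [r x = s (x + n)] outside [N], which forces [s] to be
    a unit and hence [n] to be in [R x]. So [T = R x] for every such [x], and
    the three claims follow. *)

Set Implicit Arguments.
Unset Strict Implicit.
Unset Printing Implicit Defensive.

Import GRing.Theory.
Local Open Scope classical_set_scope.
Local Open Scope ring_scope.

Lemma proper_ideal_setP (R : comNzRingType) (I : set R) :
  proper_ideal_set I <->
  [/\ I 0, ~ I 1 & forall a u v, I u -> I v -> I (a * u + v)].
Proof.
split=> [[/set_mem I0 /negP I1 ID]|[I0 I1 ID]]; split=> //.
- by move=> H1; apply: I1; apply: mem_set.
- by move=> a u v Iu Iv; apply: set_mem; apply: ID; apply: mem_set.
- exact: mem_set.
- by apply/negP => /set_mem.
- by move=> a u v /set_mem Iu /set_mem Iv; apply: mem_set; exact: ID.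
Qed.

Lemma exists_maximal_ideal (R : comNzRingType) (I : set R) :
  proper_ideal_set I -> exists2 J, maximal_ideal J & I `<=` J.
Proof.
move=> pI.
(* Zorn is applied to the sets [A] with [I `|` A] proper, so that the empty
   chain needs no separate treatment. *)
have [F FP Ftot|A [pA maxA]] :=
    @Zorn_bigcup R [set A | proper_ideal_set (I `|` A)].
  have pF X : F X -> proper_ideal_set (I `|` X) by exact: FP.
  set U := \bigcup_(X in F) X.
  (* Since the chain is totally ordered, any two elements already lie in one proper ideal inside the
     union, so closure can be checked there. *)
  have common u v : (I `|` U) u -> (I `|` U) v ->
      exists J, [/\ proper_ideal_set J, J `<=` I `|` U, J u & J v].
    have sub X : F X -> I `|` X `<=` I `|` U.
      by move=> FX w [Iw|Xw]; [left|right; exists X].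
    move=> [Iu|[X FX Xu]] [Iv|[Y FY Yv]].
    - by exists I; split=> // w; left.
    - by exists (I `|` Y); split; [exact: pF|exact: sub|left|right].
    - by exists (I `|` X); split; [exact: pF|exact: sub|right|left].
    - have [XY|YX] := Ftot _ _ FX FY.
      + by exists (I `|` Y); split;
          [exact: pF|exact: sub|right; exact: XY|right].
      + by exists (I `|` X); split;
          [exact: pF|exact: sub|right|right; exact: YX].
  have /proper_ideal_setP [I0 _ _] := pI.
  apply/proper_ideal_setP; split; first by left.
  - move=> U1; have [J [/proper_ideal_setP [_ J1 _] _ H _]] := common _ _ U1 U1.
    exact: J1.
  - move=> a u v Uu Uv.
    have [J [/proper_ideal_setP [_ _ JD] JU Ju Jv]] := common _ _ Uu Uv.
    by apply: JU; apply: JD.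
exists (I `|` A); last by move=> w; left.
split=> // J pJ IAJ; apply/seteqP; split=> //.
(* If [J] were not inside [A], it would strictly contain [A] and itself compete with [A], as [I]
   joined to [J] is just [J]. *)
apply: contrapT => nJA; apply: (maxA J).
  split; first by move=> w Aw; apply: IAJ; right.
  by move=> JA; apply: nJA => w Jw; right; exact: JA.
rewrite /= (_ : I `|` J = J) //; apply/seteqP; split=> w; last by right.
by move=> [Iw|//]; apply: IAJ; left.
Qed.

(** The multiples of a non-unit form a proper ideal; a maximal ideal above it must be [m], which
    then contains [r]. *)
Lemma quasi_local_unit (R : comNzRingType) (m : set R) (r : R) :
  quasi_local m -> ~ m r -> exists s, s * r = 1.
Proof.
move=> [_ uniq_m] nmr; apply: contrapT => nunit.
have prop_r : proper_ideal_set [set s * r | s in [set: R]].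
  apply/proper_ideal_setP; split; first by exists 0; rewrite ?mul0r.
  - by move=> [s _ sr]; apply: nunit; exists s.
  - by move=> a _ _ [s _ <-] [t _ <-]; exists (a * s + t); rewrite // mulrDl mulrA.
have [J maxJ rJ] := exists_maximal_ideal prop_r.
by apply: nmr; rewrite -(uniq_m J maxJ); apply: rJ; exists 1; rewrite ?mul1r.
Qed.

Section Submodules.
Variables (R : comNzRingType) (M : lmodType R).
Implicit Types (N K L : set M) (m : set R) (x y : M).

Lemma submoduleP N :
  submodule N <-> N 0 /\ forall a u v, N u -> N v -> N (a *: u + v).
Proof.
split=> [[/set_mem N0 ND]|[N0 ND]]; split=> //.
- by move=> a u v Nu Nv; apply: set_mem; apply: ND; apply: mem_set.
- exact: mem_set.
- by move=> a u v /set_mem Nu /set_mem Nv; apply: mem_set; exact: ND.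
Qed.

Lemma submoduleZ N a x : submodule N -> N x -> N (a *: x).
Proof. by move=> /submoduleP [N0 ND] Nx; rewrite -[_ *: _]addr0; exact: ND. Qed.

Lemma submoduleD N x y : submodule N -> N x -> N y -> N (x + y).
Proof. by move=> /submoduleP [_ ND] Nx Ny; rewrite -[x]scale1r; exact: ND. Qed.

Lemma submoduleB N x y : submodule N -> N x -> N y -> N (x - y).
Proof.
by move=> sN Nx Ny; apply: submoduleD => //; rewrite -scaleN1r; exact: submoduleZ.
Qed.

Lemma submodule_colon N m : submodule N -> submodule (colon N m).
Proof.
move=> sN; apply/submoduleP; split=> [r _|a u v Tu Tv r mr].
  by rewrite scaler0; case/submoduleP: sN.
rewrite scalerDr scalerA mulrC -scalerA; apply: submoduleD => //; last exact: Tv.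
by apply: submoduleZ => //; exact: Tu.
Qed.

Lemma sub_colon N m : submodule N -> N `<=` colon N m.
Proof. by move=> sN x Nx r _; exact: submoduleZ. Qed.

Lemma submodule_add_line N x :
  submodule N -> submodule [set n + r *: x | n in N & r in [set: R]].
Proof.
move=> sN; apply/submoduleP; split.
  exists 0; first by case/submoduleP: sN.
  by exists 0 => //; rewrite scale0r addr0.
move=> a _ _ [n Nn [r _ <-]] [p Np [s _ <-]].
exists (a *: n + p); first by apply: submoduleD => //; exact: submoduleZ.
by exists (a * r + s) => //; rewrite scalerDl scalerDr scalerA addrACA.
Qed.

Lemma submodule_line x : submodule [set r *: x | r in [set: R]].
Proof.
apply/submoduleP; split; first by exists 0; rewrite ?scale0r.
move=> a _ _ [r _ <-] [s _ <-].
by exists (a * r + s); rewrite // scalerDl scalerA.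
Qed.

(** Contrapositive of strong irreducibility, stated with witnesses. *)
Lemma strongly_irreducible_meet N K L x y :
  strongly_irreducible N -> submodule K -> submodule L ->
  K x -> ~ N x -> L y -> ~ N y -> exists z, [/\ K z, L z & ~ N z].
Proof.
move=> [_ irrN] sK sL Kx nNx Ly nNy; apply: contrapT => nmeet.
have [|KN|LN] := irrN K L sK sL.
- by move=> z [Kz Lz]; apply: contrapT => nNz; apply: nmeet; exists z.
- exact: nNx (KN _ Kx).
- exact: nNy (LN _ Ly).
Qed.

(** A scalar in [m] would send [x] into [N], so [r] lies outside [m]. *)
Lemma colon_scale_unit N m r x : quasi_local m -> colon N m x ->
  ~ N (r *: x) -> exists s, s * r = 1.
Proof. by move=> hR Tx nN; apply: (quasi_local_unit hR) => /Tx. Qed.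

Lemma colon_generated_modulo N m x y :
  quasi_local m -> strongly_irreducible N -> colon N m x -> ~ N x ->
  colon N m y -> exists2 n, N n & exists r, y = n + r *: x.
Proof.
move=> hR hN Tx nNx Ty; have [sN _] := hN.
have [Ny|nNy] := pselect (N y).
  by exists y => //; exists 0; rewrite scale0r addr0.
have N0 : N 0 by case/submoduleP: sN.
have in_line (z : M) : [set n + r *: z | n in N & r in [set: R]] z.
  by exists 0 => //; exists 1 => //; rewrite scale1r add0r.
have [z [[n Nn [r _ zx]] [p Np [s _ zy]] nNz]] :=
  strongly_irreducible_meet hN (submodule_add_line x sN)
    (submodule_add_line y sN) (in_line x) nNx (in_line y) nNy.
have [|t ts] := colon_scale_unit (r := s) hR Ty.
  by move=> Nsy; apply: nNz; rewrite -zy; exact: submoduleD.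
(* Solve [n + r *: x = p + s *: y] for [y], with [t] the inverse of [s]. *)
exists (t *: (n - p)); first by apply: submoduleZ => //; exact: submoduleB.
exists (t * r); rewrite -scalerA -scalerDr addrAC zx -zy addrC addKr.
by rewrite scalerA ts scale1r.
Qed.

Lemma colon_generated N m x :
  quasi_local m -> strongly_irreducible N -> colon N m x -> ~ N x ->
  colon N m = [set r *: x | r in [set: R]].
Proof.
move=> hR hN Tx nNx; have [sN _] := hN; have sT := submodule_colon m sN.
have sRx := submodule_line x.
have in_line (z : M) : [set r *: z | r in [set: R]] z by exists 1; rewrite ?scale1r.
apply/seteqP; split=> [y Ty|_ [r _ <-]]; last exact: submoduleZ sT Tx.
have [n Nn [r ->]] := colon_generated_modulo hR hN Tx nNx Ty.
(* It remains to absorb the error term [n] into the line through [x]. *)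
apply: (submoduleD sRx); last by exists r.
have Txn : colon N m (x + n) by exact: submoduleD sT Tx (sub_colon sN Nn).
have nNxn : ~ N (x + n).
  by move=> Nxn; apply: nNx; rewrite -[x](addrK n); exact: submoduleB.
have [_ [[a _ <-] [s _ eq_sa] nNax]] :=
  strongly_irreducible_meet hN sRx (submodule_line (x + n))
    (in_line x) nNx (in_line (x + n)) nNxn.
have [|t ts] := colon_scale_unit (r := s) hR Txn; first by rewrite eq_sa.
(* Solve [s *: (x + n) = a *: x] for [n], again dividing by the unit [s]. *)
have -> : n = (t * a) *: x - x.
  by rewrite -scalerA -eq_sa scalerA ts scale1r addrC addKr.
by apply: (submoduleB sRx) (in_line x); exists (t * a).
Qed.

End Submodules.

Theorem theorem1p1 (R : comNzRingType) (m : set R) (hR : quasi_local m)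
    (M : lmodType R) (N : set M) (hN : strongly_irreducible N)
    (hne : N <> colon N m) :
  [/\ cyclic_submodule (colon N m),
      N = ideal_mul m (colon N m)
    & forall K : set M, submodule K -> K `<=` N \/ colon N m `<=` K].
Proof.
have [sN _] := hN; have sT := submodule_colon m sN.
have [x Tx nNx] : exists2 x, colon N m x & ~ N x.
  apply: contrapT => noex; apply: hne; apply/seteqP; split.
    exact: sub_colon.
  by move=> x Tx; apply: contrapT => nNx; apply: noex; exists x.
(* Kept for all generators: the last claim applies it to an element other than [x]. *)
have gen := colon_generated hR hN.
split.
- by exists x; exact: gen.
- apply/seteqP; split=> [n Nn|]; last first.
    by apply: smallest_sub => // _ [r mr [y Ty <-]]; exact: Ty.
  have [r _ rx] : [set r *: x | r in [set: R]] n.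
    by rewrite -(gen x Tx nNx); exact: sub_colon.
  apply: sub_gen_smallest; exists r; last by exists x.
  (* Were [r] a unit, [x] would be a multiple of [n] and so lie in [N]. *)
  apply: contrapT => nmr; have [s sr] := quasi_local_unit hR nmr.
  by apply: nNx; rewrite -[x]scale1r -sr -scalerA rx; exact: submoduleZ.
- move=> K sK; have [KN|nKN] := pselect (K `<=` N); [by left|right].
  have [k Kk nNk] : exists2 k, K k & ~ N k.
    apply: contrapT => noex; apply: nKN => k Kk; apply: contrapT => nNk.
    by apply: noex; exists k.
  (* The common element [z] outside [N] generates the whole colon submodule, and it lies in [K]. *)
  have [z [Kz Tz nNz]] :=
    strongly_irreducible_meet hN sK sT Kk nNk Tx nNx.
  by rewrite (gen z Tz nNz) => _ [r _ <-]; exact: submoduleZ.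
Qed.
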